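(* Let $\mathcal{J}$ be a finite dimensional semisimple Jordan algebra over an algebraically closed field of characteristic different from $2$. Then every 2-local inner derivation on $\mathcal{J}$ is a derivation.
   Context: A derivation of $\mathcal{J}$ is a linear map $D$ with $D(xy)=D(x)y+xD(y)$. An inner derivation is a map of the form $x\mapsto\sum_{k=1}^m\big(a_k(b_kx)-b_k(a_kx)\big)$ with $a_k,b_k\in\mathcal{J}$. A 2-local inner derivation is a map $\Delta:\mathcal{J}\to\mathcal{J}$ (not assumed linear) such that for every $x,y\in\mathcal{J}$ there is an inner derivation $D$ with $\Delta(x)=D(x)$ and $\Delta(y)=D(y)$. *)

(* Defs.v *)
From HB Require Import structures.
From mathcomp Require Import all_boot all_order all_algebra.
Set Implicit Arguments. Unset Strict Implicit. Unset Printing Implicit Defensive.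
Import GRing.Theory.
Local Open Scope ring_scope.

Section Jordan.
Variables (F : fieldType) (V : vectType F) (mul : V -> V -> V).

Definition is_jordan_algebra : Prop :=
  [/\ (forall (a : F) (x y z : V), mul (a *: x + y) z = a *: mul x z + mul y z),
      (forall (a : F) (x y z : V), mul z (a *: x + y) = a *: mul z x + mul z y),
      (forall x y : V, mul x y = mul y x) &
      (forall x y : V, mul (mul x y) (mul x x) = mul x (mul y (mul x x)))].

(* Powers x^1 = x, x^(n+1) = x x^n (Jordan algebras are power-associative). *)
Fixpoint jpow (x : V) (n : nat) : V :=
  match n with
  | 0 | 1 => x
  | n'.+1 => mul x (jpow x n')
  end.

Definition jnilpotent (x : V) : Prop := exists n, (0 < n)%N /\ jpow x n = 0.

Definition jideal (I : {vspace V}) : Prop :=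
  forall x y : V, y \in I -> mul x y \in I /\ mul y x \in I.

(* Semisimple (Jacobson): the (nil) radical is zero, i.e. every nil ideal is 0. *)
Definition jsemisimple : Prop :=
  forall I : {vspace V}, jideal I -> (forall y, y \in I -> jnilpotent y) -> I = 0%VS.

Definition is_derivation (D : V -> V) : Prop :=
  (forall (a : F) (x y : V), D (a *: x + y) = a *: D x + D y) /\
  (forall x y : V, D (mul x y) = mul (D x) y + mul x (D y)).

Definition is_inner_derivation (D : V -> V) : Prop :=
  exists s : seq (V * V),
    forall x : V, D x = \sum_(p <- s) (mul p.1 (mul p.2 x) - mul p.2 (mul p.1 x)).

Definition is_2local_inner_derivation (Delta : V -> V) : Prop :=
  forall x y : V, exists D : V -> V,
    [/\ is_inner_derivation D, Delta x = D x & Delta y = D y].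

End Jordan.

(* Main.v *)
(* For a linear form t vanishing on all a(bx) - b(ax), the bilinear form t(xy) is associative, so a
   2-local inner derivation Delta satisfies t(Delta(x) y) = - t(x Delta(y)); hence the defect of
   linearity of Delta lies in the ideal R of all w such that t(wz) = 0 for all z and all such t.
   Once R = 0, Delta is linear, and Delta(x^2) = 2 x Delta(x) polarizes to the Leibniz rule.

   If R is not a nil ideal it contains a primitive idempotent f, and it suffices to find a t with
   t(f) = 1.  In positive characteristic the trace of L_x may degenerate, so t is built by hand:
   complete f to orthogonal primitive idempotents f_1, ..., f_n whose common Peirce 0-space is
   nil, and let t add up the eigenvalues lambda_i of the diagonal components in J_1(f_i).
   (a) lambda_i is additive: with the fundamental formula U_(U_x y) = U_x U_y U_x, two nilpotents
       of J_1(f_i) with invertible sum would be transported to nilpotents with sum f_i.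
   (b) For x in J_1/2(f_i) and J_1/2(f_j), x^2 has the same eigenvalue on f_i and f_j: otherwise an
       f_i would be a polynomial in x^2, and L_(f_i) would commute with L_x.
   (c) (b) and the Peirce relations make t vanish on all a(bx) - b(ax). *)
Require Import Defs.
From mathcomp Require Import all_boot all_order all_algebra.
From mathcomp Require Import ring.
From Stdlib Require Import ClassicalEpsilon.
Set Implicit Arguments. Unset Strict Implicit. Unset Printing Implicit Defensive.
Import GRing.Theory VectorInternalTheory.
Local Open Scope ring_scope.

Section JordanAlgebra.
Context (F : closedFieldType) (V : vectType F) (mul : V -> V -> V).
Hypothesis two_neq0 : 2%:R != 0 :> F.
Hypothesis Jmul : is_jordan_algebra mul.

Local Notation "x ** y" := (mul x y) (at level 40, left associativity).

(** * Bilinearity, and a tactic for certifying linear identities *)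

Lemma jmulDl x y z : (x + y) ** z = x ** z + y ** z.
Proof. by case: Jmul => mDl _ _ _; rewrite -{1}[x]scale1r mDl scale1r. Qed.

Lemma jmulC x y : x ** y = y ** x.
Proof. by case: Jmul. Qed.

Lemma jmulDr x y z : x ** (y + z) = x ** y + x ** z.
Proof. by rewrite !(jmulC x) jmulDl. Qed.

Lemma jmul0l x : 0 ** x = 0.
Proof. by apply/(addrI (0 ** x)); rewrite -jmulDl !addr0. Qed.

Lemma jmul0r x : x ** 0 = 0.
Proof. by rewrite jmulC jmul0l. Qed.

Lemma jmulZl a x y : (a *: x) ** y = a *: (x ** y).
Proof. by case: Jmul => mDl _ _ _; rewrite -[a *: x]addr0 mDl jmul0l addr0. Qed.

Lemma jmulZr a x y : x ** (a *: y) = a *: (x ** y).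
Proof. by rewrite jmulC jmulZl jmulC. Qed.

Lemma jmulNl x y : (- x) ** y = - (x ** y).
Proof. by rewrite -scaleN1r jmulZl scaleN1r. Qed.

Lemma jmulNr x y : x ** (- y) = - (x ** y).
Proof. by rewrite jmulC jmulNl jmulC. Qed.

Lemma jordan x y : (x ** y) ** (x ** x) = x ** (y ** (x ** x)).
Proof. by case: Jmul. Qed.

Let jmulE := (jmulDl, jmulDr, jmulZl, jmulZr, jmulNl, jmulNr, jmul0l, jmul0r).

(** An identity is certified as a linear combination of known ones: [lincombD] and [lincombZ] build
    the combination, and [lincomb] leaves a difference that [lin] checks in coordinates. *)
Lemma lincombD (u v u' v' : V) : u = v -> u' = v' -> u + u' = v + v'.
Proof. by move=> -> ->. Qed.
Lemma lincombZ a (u v : V) : u = v -> a *: u = a *: v.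
Proof. by move=> ->. Qed.
Lemma lincomb (u v u' v' : V) : u' = v' -> u - v = u' - v' -> u = v.
Proof. by move=> ->; rewrite subrr => /eqP; rewrite subr_eq0 => /eqP. Qed.

Ltac commute := repeat match goal with
  |- context [mul ?a ?b] => match goal with
    |- context [mul b a] => first [constr_eq a b; fail 1 | rewrite (jmulC b a)] end end.
Definition crd i (u : V) : F := v2r u 0 i.
Lemma crdD i u v : crd i (u + v) = crd i u + crd i v.
Proof. by rewrite /crd linearD mxE. Qed.
Lemma crdZ i a u : crd i (a *: u) = a * crd i u.
Proof. by rewrite /crd linearZ mxE. Qed.
Lemma crdN i u : crd i (- u) = - crd i u.
Proof. by rewrite -scaleN1r crdZ mulN1r. Qed.
Lemma crd0 i : crd i 0 = 0.
Proof. by rewrite -(scale0r 0) crdZ mul0r. Qed.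
Lemma crd_inj (u v : V) : (forall i, crd i u = crd i v) -> u = v.
Proof. by move=> uv; apply: v2r_inj; apply/rowP. Qed.
Let crdE := (crdD, crdZ, crdN, crd0).

Ltac lin := rewrite ?jmulE; commute; apply: crd_inj => ?; rewrite ?crdE;
  try ring; field; rewrite ?two_neq0 //.

(** * Linearized Jordan identities and the fundamental formula *)

Lemma jordan_lin1 x y z : (z ** y) ** (x ** x) + 2%:R *: ((x ** y) ** (x ** z))
  = z ** (y ** (x ** x)) + 2%:R *: (x ** (y ** (x ** z))).
Proof.
(* Half the difference of the identities at [x + z] and [x - z] keeps the terms odd in [z]; the
   cubic one is then removed. Only 2 is inverted. *)
apply: (lincomb (lincombD (lincombD (lincombZ (2%:R^-1) (jordan (x + z) y))
  (lincombZ (- 2%:R^-1) (jordan (x - z) y))) (lincombZ (-1) (jordan z y)))).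
lin.
Qed.

Lemma jordan4 a b c d :
  (a ** b) ** (c ** d) + (b ** c) ** (a ** d) + (c ** a) ** (b ** d) =
  ((a ** b) ** d) ** c + ((b ** c) ** d) ** a + ((c ** a) ** d) ** b.
Proof.
apply: (lincomb (lincombZ (2%:R^-1) (lincombD (jordan_lin1 (a + b) d c)
  (lincombD (lincombZ (-1) (jordan_lin1 a d c)) (lincombZ (-1) (jordan_lin1 b d c)))))).
lin.
Qed.

(* Half of the Jordan triple product {x y z}, so that U_x y = tp x y x. *)
Definition tp x y z := (x ** y) ** z + (z ** y) ** x - (x ** z) ** y.

(** The pair (L_c, -L_c) acts as a derivation of the Jordan pair given by [tp]. *)
Lemma mul_tp c u v w :
  c ** tp u v w = tp (c ** u) v w - tp u (c ** v) w + tp u v (c ** w).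
Proof.
apply: (lincomb (lincombD (jordan4 u w c v)
  (lincombD (lincombZ (-1) (jordan4 v w c u)) (lincombZ (-1) (jordan4 u v c w))))).
rewrite /tp.
lin.
Qed.

Definition der a b x := a ** (b ** x) - b ** (a ** x).

(** The left side of [jordan4] is symmetric in all four arguments while the right side singles out
    the last one; exchanging [a] and [b] and subtracting leaves the Leibniz rule. *)
Lemma derM a b x y : der a b (x ** y) = der a b x ** y + x ** der a b y.
Proof.
apply: (lincomb (lincombD (jordan4 b x y a) (lincombZ (-1) (jordan4 a x y b)))).
rewrite /der.
lin.
Qed.

Lemma der_tp a b u v w :
  der a b (tp u v w) = tp (der a b u) v w + tp u (der a b v) w + tp u v (der a b w).
Proof.
have derD x y : der a b (x + y) = der a b x + der a b y by rewrite /der; lin.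
have derN x : der a b (- x) = - der a b x by rewrite /der; lin.
rewrite {1}/tp !derD derN !derM /tp; lin.
Qed.

Lemma tpE x y z : tp x y z = (x ** y) ** z + der x y z.
Proof. by rewrite /tp /der; lin. Qed.

Lemma tpC x y z : tp x y z = tp z y x.
Proof. by rewrite /tp; lin. Qed.

(** By [tpE], the map u -> {x y u} is L_(xy) + [L_x, L_y]; exchanging x and y changes only the sign
    of the derivation, whence the middle term. *)
Lemma tp5 x y u v w : tp x y (tp u v w) =
  tp (tp x y u) v w - tp u (tp y x v) w + tp u v (tp x y w).
Proof.
have derC z : der y x z = - der x y z by rewrite /der; lin.
rewrite tpE mul_tp der_tp (tpE x y u) (tpE y x v) (tpE x y w) derC (jmulC y x).
rewrite /tp; lin.
Qed.

(** [tp5] yields only three times this equation, so a direct certificate from the Jordan identity is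
    used; it is valid in characteristic 3. *)
Lemma tp_shift x w y : tp x w (tp x y x) = tp x (tp w x y) x.
Proof.
have mw := congr1 (mul w) (jordan x y); have mx := congr1 (mul x) (jordan4 x w y x).
have mx' := congr1 (mul x) (jordan4 x x w y).
apply: (lincomb (lincombD (lincombD (lincombZ (-1) mw) (lincombZ (-1) (jordan x (w ** y))))
  (lincombD (lincombD (lincombZ (-1) (jordan4 x x w (x ** y))) (lincombZ (- 2%:R) mx))
   (lincombD (lincombD (jordan4 x x (x ** w) y) mx') (lincombZ 2%:R (jordan4 x w (x ** y) x)))))).
rewrite /tp.
lin.
Qed.

Definition U x y := tp x y x.

Lemma UE x y : U x y = 2%:R *: (x ** (x ** y)) - (x ** x) ** y.
Proof. by rewrite /U /tp; lin. Qed.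

(** [tp5] expands both sides until [tp_shift] can pull U_x out of every term; the arguments left
    inside agree. *)
Lemma fundamental_formula x y z : U (U x y) z = U x (U y (U x z)).
Proof.
rewrite /U; set m := tp x y x.
have e1 : tp m z m = tp x y (tp x z m) + tp x (tp y x z) m - tp x z (tp x y m).
  by rewrite (tp5 x y x z m) -/m; lin.
have e2 : tp y (tp x z x) y = 2%:R *: tp y x (tp y x z) - tp z x (tp y x y).
  by rewrite (tp5 z x y x y) (tpC z x y) (tpC (tp y x z)) -!scaleN1r; lin.
have tpxD a b : tp x (a + b) x = tp x a x + tp x b x by rewrite /tp; lin.
have tpxZ a k : tp x (k *: a) x = k *: tp x a x by rewrite /tp; lin.
rewrite e1 e2 /m !tp_shift (tpC z x y) (tpC (tp y x z)) -!scaleN1r !(tpxD, tpxZ).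
lin.
Qed.

(** * Powers and polynomials *)

Lemma mul_mul_mul a b c z : a ** (b ** (c ** z)) + c ** (b ** (a ** z)) + ((a ** c) ** b) ** z
  = (a ** b) ** (c ** z) + (b ** c) ** (a ** z) + (c ** a) ** (b ** z).
Proof.
apply: (lincomb (lincombZ (-1) (jordan4 a c z b))).
lin.
Qed.

Definition lcomm x y := forall z, x ** (y ** z) = y ** (x ** z).

Lemma lcomm_idem e x c : c != 2%:R^-1 -> e ** e = e -> e ** x = c *: x -> lcomm e x.
Proof.
move=> c2 ee ex z.
have e1 : (1 - 2%:R * c) *: (e ** (x ** z) - x ** (e ** z)) = 0.
  by apply: (lincomb (jordan4 e e x z)); rewrite (jmulC x e) ee ex; lin.
have c2' : 1 - 2%:R * c != 0.
  apply: contra c2; rewrite subr_eq0 => /eqP c1.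
  by apply/eqP/(mulfI two_neq0); rewrite -c1 divff.
by move: e1 => /eqP; rewrite scaler_eq0 (negPf c2') subr_eq0 => /eqP.
Qed.

Lemma lcomm_sqr x : lcomm x (x ** x).
Proof. by move=> z; rewrite (jmulC (x ** x)) -jordan jmulC. Qed.

(** Indexed by the number of multiplications: [pw x x n] is x^(n+1), whereas [pw e x n] is x^n when
    [e] is a unit for [x]. *)
Definition pw (u x : V) n := iter n (mul x) u.

(** By the recursion [pE], multiplication by a power of [x] is a polynomial in L_x and L_(x^2), so
    whatever commutes with these two commutes with it. *)
Lemma comm_pw x (T : V -> V) n : (forall u v, T (u + v) = T u + T v) ->
    (forall z, x ** T z = T (x ** z)) -> (forall z, (x ** x) ** T z = T ((x ** x) ** z)) ->
  forall z, pw x x n ** T z = T (pw x x n ** z).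
Proof.
move=> TD Tx Txx.
have TN u : T (- u) = - T u.
  have T0 : T 0 = 0 by apply: (addrI (T 0)); rewrite -TD !addr0.
  by apply: (addrI (T u)); rewrite -TD !subrr.
suff: (forall z, pw x x n ** T z = T (pw x x n ** z)) /\
      (forall z, pw x x n.+1 ** T z = T (pw x x n.+1 ** z)) by case.
elim: n => [|n [IH IH1]]; split=> // z.
have pE y : pw x x n.+2 ** y = (x ** x) ** (pw x x n ** y) + pw x x n.+1 ** (x ** y) +
    pw x x n.+1 ** (x ** y) - x ** (x ** (pw x x n ** y)) - pw x x n ** (x ** (x ** y)).
  have := mul_mul_mul x x (pw x x n) y.
  rewrite -[x ** pw x x n]/(pw x x n.+1) (jmulC _ x) (jmulC _ x).
  rewrite -[x ** pw _ _ n.+1]/(pw x x n.+2) => h.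
  apply: (lincomb h); lin.
by rewrite !pE !(TD, TN) -!(Tx, Txx, IH, IH1).
Qed.

Lemma lcomm_pw x m n : lcomm (pw x x m) (pw x x n).
Proof.
have xpw k : lcomm x (pw x x k).
  by move=> z; rewrite (@comm_pw x (mul x)) // => *; rewrite ?jmulDr ?lcomm_sqr.
have xxpw k : lcomm (x ** x) (pw x x k).
  by move=> z; rewrite (@comm_pw x (mul (x ** x))) // => *; rewrite ?jmulDr ?lcomm_sqr.
by move=> z; rewrite (@comm_pw x (mul (pw x x n))) // => *; rewrite ?jmulDr ?xpw ?xxpw.
Qed.

Lemma pw_unit e x n : e ** x = x -> pw e x n.+1 = pw x x n.
Proof. by move=> ex; rewrite /pw iterSr jmulC ex. Qed.

Lemma lcomm_pw_unit e x n : e ** e = e -> e ** x = x -> lcomm x (pw e x n).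
Proof.
move=> ee ex; case: n => [z|n]; last by rewrite pw_unit //; exact: (lcomm_pw x 0).
rewrite /pw /= (@lcomm_idem e x 1) ?scale1r //.
by rewrite -(inj_eq (mulfI two_neq0)) mulr1 divff // -subr_eq0 addrK oner_neq0.
Qed.

(* [ev u x p] is p(L_x) u; for [u = x] it is the value at x of X p(X), which needs no unit. *)
Definition ev u x (p : {poly F}) := \sum_(i < size p) p`_i *: pw u x i.

Lemma ev_widen u x (p : {poly F}) n : (size p <= n)%N -> ev u x p = \sum_(i < n) p`_i *: pw u x i.
Proof.
move=> pn; rewrite /ev (big_ord_widen n (fun i => p`_i *: pw u x i)) // big_mkcond.
by apply: eq_bigr => i _; case: ltnP => // ?; rewrite nth_default ?scale0r.
Qed.

Lemma evD u x p q : ev u x (p + q) = ev u x p + ev u x q.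
Proof.
pose n := maxn (size p) (size q).
rewrite (@ev_widen u x p n) ?leq_maxl // (@ev_widen u x q n) ?leq_maxr //.
rewrite (@ev_widen u x _ n) ?size_polyD // -big_split /=.
by apply: eq_bigr => i _; rewrite coefD scalerDl.
Qed.

Lemma evZ u x c p : ev u x (c *: p) = c *: ev u x p.
Proof.
rewrite (@ev_widen u x _ (size p)) ?size_scale_leq // scaler_sumr.
by apply: eq_bigr => i _; rewrite coefZ scalerA.
Qed.

Lemma ev0 u x : ev u x 0 = 0.
Proof. by rewrite -(scale0r 0) evZ scale0r. Qed.

Lemma evN u x p : ev u x (- p) = - ev u x p.
Proof. by rewrite -scaleN1r evZ scaleN1r. Qed.

Lemma evC u x c : ev u x c%:P = c *: u.
Proof.
by rewrite (@ev_widen u x _ 1) ?size_polyC_leq1 // big_ord1 coefC.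
Qed.

Lemma ev1 u x : ev u x 1 = u.
Proof. by rewrite evC scale1r. Qed.

Lemma evMX u x p : ev u x (p * 'X) = x ** ev u x p.
Proof.
have [->|p0] := eqVneq p 0; first by rewrite mul0r ev0 jmul0r.
rewrite /ev size_mulX // big_ord_recl coefMX scale0r add0r.
rewrite (big_morph (mul x) (jmulDr x) (jmul0r x)).
by apply: eq_bigr => i _; rewrite coefMX jmulZr.
Qed.

Lemma evX u x : ev u x 'X = x ** u.
Proof. by rewrite -[X in ev u x X]mul1r evMX ev1. Qed.

Lemma evXn u x n : ev u x 'X^n = pw u x n.
Proof. by elim: n => [|n IH]; rewrite ?ev1 // exprSr evMX IH. Qed.

Lemma lcomm_sum x (I : Type) (r : seq I) (P : pred I) (G : I -> V) :
  (forall i, P i -> lcomm x (G i)) -> lcomm x (\sum_(i <- r | P i) G i).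
Proof.
move=> xG; elim/big_ind: _ => // [z|u v xu xv z]; first by rewrite !jmul0l jmul0r.
by rewrite !jmulDl jmulDr xu xv.
Qed.

Lemma lcomm_ev x u : (forall n, lcomm x (pw u x n)) -> forall p, lcomm x (ev u x p).
Proof.
by move=> xu p; apply: lcomm_sum => i _ z; rewrite jmulZl jmulZr xu jmulZl.
Qed.

Lemma ev_unit e x p : e ** e = e -> e ** x = x -> e ** ev e x p = ev e x p.
Proof.
move=> ee ex; have ecx : lcomm e x by move=> z; rewrite -(lcomm_pw_unit 0 ee ex).
elim/poly_ind: p => [|p c IH]; first by rewrite ev0 jmul0r.
by rewrite evD evMX evC jmulDr jmulZr ee ecx IH.
Qed.

Lemma evM e x p q : e ** e = e -> e ** x = x -> ev e x p ** ev e x q = ev e x (p * q).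
Proof.
move=> ee ex; have xev := lcomm_ev (fun n => lcomm_pw_unit n ee ex).
elim/poly_ind: p => [|p c IH]; first by rewrite mul0r !ev0 jmul0l.
rewrite mulrDl mulrAC !evD !evMX evC mul_polyC evZ jmulDl jmulZl ev_unit //.
by rewrite -IH [in RHS](jmulC (ev e x p)) (xev q) jmulC.
Qed.

Lemma evM_nonunital x p q : ev x x p ** ev x x q = ev x x (p * q * 'X).
Proof.
have xev := lcomm_ev (lcomm_pw x 0).
elim/poly_ind: p => [|p c IH]; first by rewrite !mul0r !ev0 jmul0l.
rewrite mulrDl mulrAC mulrDl !evD !evMX evC mul_polyC evZ jmulDl !jmulZr jmulZl.
by rewrite -[x ** ev x x (p * q)]evMX -IH [in RHS](jmulC (ev x x p)) (xev q) jmulC.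
Qed.

Lemma ev_nonunital e x p : e ** x = x -> ev x x p = ev e x (p * 'X).
Proof.
move=> ex; elim/poly_ind: p => [|p c IH]; first by rewrite mul0r !ev0.
by rewrite mulrDl !evD !evMX !evC IH evMX jmulZr (jmulC x e) ex.
Qed.


(** * Peirce decomposition *)

Local Notation half := (2%:R^-1 : F).

Definition in1 e x := e ** x = x.
Definition inh e x := e ** x = half *: x.
Definition in0 e x := e ** x = 0.
Definition idem e := e ** e = e.

Lemma Ur0 x : U x 0 = 0.
Proof. by rewrite UE !jmul0r scaler0 subr0. Qed.

Lemma half_neq1 : 1 != half.
Proof. by rewrite -(inj_eq (mulfI two_neq0)) mulr1 divff // -subr_eq0 addrK oner_neq0. Qed.

Lemma half_neq0 : 0 != half.
Proof. by rewrite eq_sym invr_eq0. Qed.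

Lemma double_half (x : V) : 2%:R *: (half *: x) = x.
Proof. by rewrite scalerA divff // scale1r. Qed.

(** L_e is a root of 2X^3 - 3X^2 + X, so its eigenvalues are among 0, 1/2 and 1. *)
Lemma peirce_cubic e x : idem e ->
  2%:R *: (e ** (e ** (e ** x))) = 3%:R *: (e ** (e ** x)) - e ** x.
Proof.
move=> ee; apply: (lincomb (mul_mul_mul e e e x)); rewrite !ee; lin.
Qed.

(** Lagrange interpolation in L_e: [peirceh] for the node 1/2, [peirce0] for the node 0; [U e] is
    the projection for the node 1. *)
Definition peirceh e x := 4%:R *: (e ** x - e ** (e ** x)).
Definition peirce0 e x := x - 3%:R *: (e ** x) + 2%:R *: (e ** (e ** x)).

Section Peirce.
Variable e : V.
Hypothesis ee : idem e.

Lemma peirce_sum x : x = U e x + peirceh e x + peirce0 e x.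
Proof. by rewrite UE ee /peirceh /peirce0; lin. Qed.

Lemma U_in1 x : in1 e (U e x).
Proof. by rewrite /in1 UE ee jmulDr jmulZr peirce_cubic //; lin. Qed.

Lemma peirceh_in x : inh e (peirceh e x).
Proof.
rewrite /inh /peirceh.
by apply: (lincomb (lincombZ (- 2%:R) (peirce_cubic x ee))); lin.
Qed.

Lemma peirce0_in x : in0 e (peirce0 e x).
Proof. by rewrite /in0 /peirce0; apply: (lincomb (peirce_cubic x ee)); lin. Qed.

Lemma lcomm_in1 x : in1 e x -> lcomm e x.
Proof. by move=> ex; apply: (lcomm_idem half_neq1 ee); rewrite scale1r. Qed.

Lemma lcomm_in0 x : in0 e x -> lcomm e x.
Proof. by move=> ex; apply: (lcomm_idem half_neq0 ee); rewrite scale0r. Qed.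

Lemma in11 x y : in1 e x -> in1 e y -> in1 e (x ** y).
Proof. by move=> ex ey; rewrite /in1 lcomm_in1 // ey. Qed.

Lemma in00 x y : in0 e x -> in0 e y -> in0 e (x ** y).
Proof. by move=> ex ey; rewrite /in0 lcomm_in0 // ey jmul0r. Qed.

Lemma in10 x y : in1 e x -> in0 e y -> x ** y = 0.
Proof.
by move=> ex ey; rewrite -[x in LHS]ex jmulC -(lcomm_in0 ey) jmulC (jmulC y) (jmulC _ e)
  (lcomm_in1 ex) ey jmul0r.
Qed.

Lemma in1h x y : in1 e x -> inh e y -> inh e (x ** y).
Proof. by move=> ex ey; rewrite /inh lcomm_in1 // ey jmulZr. Qed.

Lemma in0h x y : in0 e x -> inh e y -> inh e (x ** y).
Proof. by move=> ex ey; rewrite /inh lcomm_in0 // ey jmulZr. Qed.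

Lemma inhh1 x y : inh e x -> inh e y -> in1 e (e ** (x ** y)).
Proof.
move=> ex ey; rewrite /in1; apply: (lincomb (lincombZ (-1) (jordan4 x y e e))).
by rewrite !ee ?(jmulC _ e) ?ex ?ey ?jmulE ?(jmulC _ e) ?ex ?ey; lin.
Qed.

Lemma inhh0 x y : inh e x -> inh e y -> in0 e (x ** y - e ** (x ** y)).
Proof. by move=> ex ey; rewrite /in0 jmulDr jmulNr inhh1 // subrr. Qed.

(** Since b(ac) has no J_1/2 component, the left side is twice its J_1 component, whose trace
    [trace_assoc] equates with that of b(ac). *)
Lemma peirce_hh1 a b c : inh e a -> inh e b -> in1 e c ->
  2%:R *: (e ** (b ** (a ** c))) = c ** (a ** b) + b ** (a ** c) - a ** (b ** c).
Proof.
move=> ea eb ec; apply: (lincomb (lincombZ (- 2%:R) (jordan4 a c e b))).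
rewrite (jmulC c e) ec ea eb; lin.
Qed.

Lemma peirce_hh0 a b c : inh e a -> inh e b -> in0 e c ->
  2%:R *: (e ** (b ** (a ** c))) = b ** (a ** c) + a ** (b ** c) - c ** (a ** b).
Proof.
move=> ea eb ec; apply: (lincomb (lincombZ (- 2%:R) (jordan4 a c e b))).
rewrite (jmulC c e) ec ea eb; lin.
Qed.

Lemma U1 x : in1 e x -> U e x = x.
Proof. by move=> ex; rewrite UE ee !ex; lin. Qed.

Lemma Uh x : inh e x -> U e x = 0.
Proof. by move=> ex; rewrite UE ee !ex jmulZr ex; lin. Qed.

Lemma U0 x : in0 e x -> U e x = 0.
Proof. by move=> ex; rewrite UE ee !ex jmul0r; lin. Qed.

Lemma in1D x y : in1 e x -> in1 e y -> in1 e (x + y).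
Proof. by rewrite /in1 jmulDr => -> ->. Qed.

Lemma in1Z a x : in1 e x -> in1 e (a *: x).
Proof. by rewrite /in1 jmulZr => ->. Qed.

Lemma in1N x : in1 e x -> in1 e (- x).
Proof. by rewrite /in1 jmulNr => ->. Qed.

Lemma in1U x y : in1 e x -> in1 e y -> in1 e (U x y).
Proof. by move=> ex ey; rewrite UE; apply: in1D; [apply/in1Z|apply/in1N]; do ?apply: in11. Qed.

Lemma in1ev x p : in1 e x -> in1 e (ev e x p).
Proof. exact: ev_unit. Qed.


End Peirce.

Hint Resolve in1D in1Z in1N in1U in1ev in11 : peirce.


(** * Idempotents and nilpotent elements *)

Lemma ev_mulr u x p q : ev u x p = 0 -> ev u x (p * q) = 0.
Proof.
move=> p0; elim/poly_ind: q => [|q c IH]; first by rewrite mulr0 ev0.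
by rewrite mulrDr mulrA evD evMX IH jmul0r mulrC mul_polyC evZ p0 scaler0 addr0.
Qed.

Lemma ev_coprime u x p q : ev u x p = 0 -> ev u x q = 0 -> coprimep p q -> u = 0.
Proof.
move=> p0 q0 /Bezout_eq1_coprimepP[[a b] /= ab].
by rewrite -(ev1 u x) -ab evD mulrC (ev_mulr _ p0) mulrC (ev_mulr _ q0) addr0.
Qed.

Lemma ev_comp e x p q : idem e -> in1 e x -> ev e (ev e x q) p = ev e x (p \Po q).
Proof.
move=> ee ex; elim/poly_ind: p => [|p c IH]; first by rewrite comp_poly0 !ev0.
by rewrite comp_poly_MXaddC !evD !evC evMX IH evM // mulrC.
Qed.

Lemma ev_annihilator u x : exists2 p : {poly F}, p != 0 & ev u x p = 0.
Proof.
set d := dim V; pose M : 'M[F]_(d.+1, d) := \matrix_(i < d.+1) v2r (pw u x i).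
have : kermx M != 0.
  rewrite kermx_eq0 -row_leq_rank -ltnNge ltnS; exact: rank_leq_col.
case/rowV0Pn => v /sub_kermxP vM v0; exists (rVpoly v).
  by apply: contra v0 => /eqP v0; rewrite -[v]rVpolyK v0 linear0.
rewrite (@ev_widen _ _ _ d.+1) ?size_poly //; apply: v2r_inj.
rewrite linear0 -vM linear_sum mulmx_sum_row; apply: eq_bigr => i _.
by rewrite rowK linearZ coef_rVpoly_ord.
Qed.

Definition jnil x := exists n, pw x x n = 0.

Lemma jnil_jnilpotent x : jnil x -> jnilpotent mul x.
Proof.
case=> n nx; exists n.+1; split=> //; rewrite -nx.
by elim: n {nx} => [|n IH] //=; rewrite -IH.
Qed.

(** Fitting's argument. Let Xp kill [y], with p = X^k r, r(0) nonzero and u X^(k+1) + v r = 1. Then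
    u X^(k+1) is idempotent modulo Xp, and if its value at [y] is 0, then y^(k+1) = 0. *)
Lemma nil_or_idem y : jnil y \/ exists2 q, ev y y q != 0 & idem (ev y y q).
Proof.
have [p p0 yp] := ev_annihilator y y.
have [k [r]] := multiplicity_XsubC p 0; rewrite p0 /= subr0 => r0 pE.
have : coprimep 'X^(k.+1) r.
  by rewrite -['X](subr0 'X) -polyC0 coprimep_expl // coprimep_sym coprimep_XsubC.
case/Bezout_eq1_coprimepP => -[u v] /= uv.
have XrE : p = 'X^k * r by rewrite mulrC.
have [g0|g0] := eqVneq (ev y y (u * 'X^k)) 0; [left|right].
  exists k; rewrite -(evXn y y k) -['X^k]mulr1 -uv.
  have -> : 'X^k * (u * 'X^(k.+1) + v * r) = u * 'X^k * 'X^(k.+1) + p * v.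
    by rewrite XrE; ring.
  by rewrite evD (ev_mulr _ g0) (ev_mulr _ yp) addr0.
exists (u * 'X^k) => //; rewrite /idem evM_nonunital.
have -> : u * 'X^k * (u * 'X^k) * 'X = u * 'X^k + p * (- u * v).
  have -> : u * 'X^k * (u * 'X^k) * 'X = u * 'X^k * (u * 'X^(k.+1)).
    by rewrite exprS; ring.
  have -> : u * 'X^(k.+1) = 1 - v * r by rewrite -uv addrK.
  by rewrite XrE; ring.
by rewrite evD (ev_mulr _ yp) addr0.
Qed.

(** A primitive idempotent, named after J_1(e), where each element is nil or invertible by
    [local_inv]. *)
Definition local e := [/\ idem e, e <> 0 & forall g, idem g -> in1 e g -> g = 0 \/ g = e].

(** * The Peirce 1-space of a primitive idempotent *)

Section Local.
Variable e : V.
Hypothesis le : local e.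
Let ee : idem e. Proof. by case: le. Qed.

Lemma local_inv y : in1 e y -> jnil y \/ exists r, ev e y ('X * r) = e.
Proof.
move=> ey; have [|[q q0 qq]] := nil_or_idem y; [by left|right; exists q].
rewrite mulrC -(ev_nonunital _ ey); case: le => _ _ /(_ _ qq)[|q0'|//].
  by rewrite (ev_nonunital _ ey); apply: in1ev.
by rewrite q0' eqxx in q0.
Qed.

(** A product of linear factors in [y] kills [e]. Invertible factors can be cancelled, and as [e] is
    nonzero they cannot all be, so some factor is nil. *)
Lemma local_decomp y : in1 e y -> exists a, jnil (y - a *: e).
Proof.
move=> ey; have [p p0 yp] := ev_annihilator e y.
have [s pE] := closed_field_poly_normal p.
have {pE yp} : ev e y (\prod_(a <- s) ('X - a%:P)) = 0.
  apply/eqP; move/eqP: yp; rewrite pE evZ scaler_eq0.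
  by rewrite lead_coef_eq0 (negPf p0).
elim: s => [|a s IH]; first by rewrite big_nil ev1; case: le.
rewrite big_cons => ps.
have zE : y - a *: e = ev e y ('X - a%:P).
  by rewrite evD evN evX evC (jmulC y) ey.
have ez : in1 e (y - a *: e) by rewrite zE; apply: in1ev.
have [|[r rE]] := local_inv ez; first by exists a.
apply: IH; rewrite -[LHS]ev_unit // -{1}rE zE ev_comp // evM //.
by rewrite comp_polyM comp_polyX mulrAC ev_mulr.
Qed.

Lemma jnil_unit x : in1 e x -> (exists n, pw e x n = 0) <-> jnil x.
Proof.
move=> ex; split=> -[n nx]; last by exists n.+1; rewrite pw_unit.
by exists n; rewrite -(pw_unit n ex) /pw iterS -/(pw e x n) nx jmul0r.
Qed.

Lemma jnil_uniq x c : in1 e x -> jnil x -> jnil (x + c *: e) -> c = 0.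
Proof.
move=> ex /(jnil_unit ex)[m nm]; have exc : in1 e (x + c *: e) by auto with peirce.
have xcE : x + c *: e = ev e x ('X - (- c)%:P).
  by rewrite evD evN evX evC (jmulC x) ex scaleNr opprK.
case/(jnil_unit exc)=> n; rewrite xcE -evXn ev_comp // comp_Xn_poly => nn.
apply/eqP; apply: contraT => c0; case: le => _ e0 _; case: e0.
move: nm; rewrite -evXn => /ev_coprime/(_ nn); apply.
apply/coprimep_expl/coprimep_expr.
by rewrite coprimep_XsubC rootX oppr_eq0.
Qed.

Lemma jnilZ x c : jnil x -> jnil (c *: x).
Proof.
case=> n nx; exists n; suff -> : pw (c *: x) (c *: x) n = c ^+ n.+1 *: pw x x n.
  by rewrite nx scaler0.
elim: n {nx} => [|n IH] //=; rewrite -/(pw _ _ n) IH jmulZl jmulZr scalerA -exprS //.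
Qed.

(** Hensel lifting of (1 + X)^(-1/2) modulo X^(k+1), with 2 the only denominator. *)
Lemma inv_sqrt_poly k : exists r d : {poly F},
  (r * 'X + 1) * (r * 'X + 1) * (1 + 'X) = 1 + 'X^(k.+1) * d.
Proof.
elim: k => [|k [r [d]]]; first by exists 0, 1; rewrite expr1; ring.
elim/poly_ind: d => [|d c _] rE.
  by exists r, 0; rewrite rE !mulr0.
(* This lowers the root by (c/2) X^(k+1), which cancels the constant term [c] of the old error. *)
exists (r - (half * c)%:P * 'X^k).
exists (d - c%:P * (r + r * 'X + 1) + (half * c)%:P * (half * c)%:P * 'X^k * (1 + 'X)).
have cE : c%:P = 2%:R * (half * c)%:P :> {poly F}.
  by rewrite -[X in X * _](rmorph_nat polyC) -polyCM mulVKf.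
set g := (half * c)%:P in cE *.
transitivity ((r * 'X + 1) * (r * 'X + 1) * (1 + 'X)
    - 2%:R * g * 'X^(k.+1) * (r * 'X + 1) * (1 + 'X)
    + g * g * ('X^k * 'X) * ('X^k * 'X) * (1 + 'X)).
  by rewrite exprS; ring.
by rewrite rE cE !exprS; ring.
Qed.

(** If U_a b = e, the fundamental formula makes U_a U_b U_a the identity on J_1(e), so U_a is
    injective there; [U_surj] rests on the same equation. *)
Lemma U_inj a b z : U a b = e -> in1 e z -> U a z = 0 -> z = 0.
Proof.
move=> ab ez az; have <- := U1 ee ez.
by rewrite -ab fundamental_formula az !Ur0.
Qed.

Lemma U_surj a b z : U a b = e -> in1 e z -> U a (U b (U a z)) = z.
Proof. by move=> ab ez; rewrite -fundamental_formula ab U1. Qed.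

(** The witness is the last nonzero power of [x], where x^0 is [e]. *)
Lemma nil_annihilator x : in1 e x -> jnil x -> exists z, [/\ z <> 0, in1 e z & U x z = 0].
Proof.
move=> ex /(jnil_unit ex)[m0 nm0].
have exm : exists m, pw e x m == 0 by exists m0; rewrite nm0.
case: (ex_minnP exm) => -[|m]; first by case: le => _ e0 _ /eqP/e0.
move=> /eqP xm mmin; exists (pw e x m); split.
- by move=> /eqP/mmin; rewrite ltnn.
- by rewrite -evXn; apply: in1ev.
have xz : x ** pw e x m = 0 by [].
rewrite UE xz (jmulC (x ** x)) -(lcomm_pw_unit m ee ex) (jmulC _ x) xz.
by rewrite jmul0r scaler0 subrr.
Qed.

(** Were U_c x invertible, U_(U_c x) = U_c U_x U_c would be injective on J_1(e). For z killed by U_x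
    it sends U_u U_c z to U_c U_x z = 0, so U_u U_c z = 0 and z = U_c U_u U_c z = 0. *)
Lemma U_nil_not_inv c u x r : in1 e c -> in1 e u -> U c u = e -> in1 e x -> jnil x ->
  ev e (U c x) ('X * r) = e -> False.
Proof.
move=> ec eu cu ex xn rE; have [z [z0 ez xz]] := nil_annihilator ex xn.
have ex' : in1 e (U c x) by auto with peirce.
have Uw : U (U c x) (ev e (U c x) (r * r)) = e.
  have xE : U c x = ev e (U c x) 'X by rewrite evX jmulC ex'.
  rewrite UE {1 2 4 5}xE !evM //.
  have -> : 'X * ('X * (r * r)) = 'X * r * ('X * r) :> {poly F} by ring.
  have -> : 'X * 'X * (r * r) = 'X * r * ('X * r) :> {poly F} by ring.
  by rewrite -evM // rE ee scaler_nat mulr2n addrK.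
apply: z0; rewrite -(U_surj cu ez).
suff -> : U u (U c z) = 0 by rewrite Ur0.
apply: (U_inj Uw); first by auto with peirce.
rewrite fundamental_formula (U_surj cu ez) xz.
by rewrite Ur0.
Qed.

(** With c = (e + n)^(-1/2), U_c turns the sum into U_c x + U_c y = e. Neither term is invertible,
    so both are nil, against the uniqueness of the eigenvalue. *)
Lemma nil_sum_neq_inv x y n : in1 e x -> in1 e y -> in1 e n ->
  jnil x -> jnil y -> jnil n -> x + y = e + n -> False.
Proof.
move=> ex ey en nx ny /(jnil_unit en)[k nk] xyE.
have [r [d rE]] := inv_sqrt_poly k; pose c := ev e n (r * 'X + 1).
have ec : in1 e c by apply: in1ev.
have uE : e + n = ev e n (1 + 'X) by rewrite evD ev1 evX (jmulC n) en.
have eu : in1 e (e + n) by auto with peirce.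
have cu : U c (e + n) = e.
  rewrite UE uE !evM // mulrA rE evD ev1 exprSr -mulrA ev_mulr ?evXn //.
  by rewrite addr0 scaler_nat mulr2n addrK.
have xyE' : U c x + U c y = e by rewrite -cu -xyE !UE; lin.
have [ex' ey'] : in1 e (U c x) /\ in1 e (U c y) by auto with peirce.
have [nx'|[s sE]] := local_inv ex'; last exact: (U_nil_not_inv ec eu cu ex nx sE).
have [ny'|[s sE]] := local_inv ey'; last exact: (U_nil_not_inv ec eu cu ey ny sE).
have n1 : jnil (- U c x) by rewrite -scaleN1r; apply: jnilZ.
have n2 : jnil (- U c x + 1 *: e) by rewrite scale1r -xyE' addKr.
by move: (jnil_uniq (in1N ex') n1 n2) => /eqP; rewrite oner_eq0.
Qed.

(* The absence of nodal Jordan algebras. *)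
Lemma nil_add x y : in1 e x -> in1 e y -> jnil x -> jnil y -> jnil (x + y).
Proof.
move=> ex ey nx ny; have [a na] := local_decomp (in1D ex ey).
have [a0|a0] := eqVneq a 0; first by rewrite a0 scale0r subr0 in na.
exfalso; apply: (@nil_sum_neq_inv (a^-1 *: x) (a^-1 *: y) (a^-1 *: (x + y - a *: e)));
  auto using jnilZ with peirce.
by rewrite scalerBr scalerA mulVf // scale1r [RHS]addrC subrK scalerDr.
Qed.

(* The eigenvalue of [x]; junk unless [x] is in J_1(e). *)
Definition lam x : F := epsilon (inhabits 0) (fun a => jnil (x - a *: e)).

Lemma lamP x : in1 e x -> jnil (x - lam x *: e).
Proof. by move=> ex; apply: (epsilon_spec _ _ (local_decomp ex)). Qed.

Lemma lam_uniq x a : in1 e x -> jnil (x - a *: e) -> lam x = a.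
Proof.
move=> ex na; apply/eqP; rewrite eq_sym -subr_eq0; apply/eqP.
apply: (jnil_uniq _ na); first by auto with peirce.
by rewrite scalerBl addrA subrK; apply: lamP.
Qed.

Lemma lamD x y : in1 e x -> in1 e y -> lam (x + y) = lam x + lam y.
Proof.
move=> ex ey; apply: lam_uniq; first exact: in1D.
have -> : x + y - (lam x + lam y) *: e = (x - lam x *: e) + (y - lam y *: e) by lin.
by apply: nil_add; auto using lamP with peirce.
Qed.

Lemma lamZ a x : in1 e x -> lam (a *: x) = a * lam x.
Proof.
move=> ex; apply: lam_uniq; first exact: in1Z.
have -> : a *: x - (a * lam x) *: e = a *: (x - lam x *: e) by lin.
exact/jnilZ/lamP.
Qed.

Lemma lam_sqr x : in1 e x -> lam (x ** x) = lam x * lam x.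
Proof.
move=> ex; apply: lam_uniq; first exact: in11.
set a := lam x; set n := x - a *: e.
have en : in1 e n by rewrite /n; auto with peirce.
have [k nk] := iffRL (jnil_unit en) (lamP ex).
have -> : x ** x - (a * a) *: e = ev e n ('X * ('X + (2%:R * a)%:P)).
  have -> : x = n + a *: e by rewrite subrK.
  clearbody n; rewrite mulrDr !evD (mulrC 'X _%:P) mul_polyC evZ evMX !evX (jmulC n e) en.
  by rewrite !jmulE (jmulC n e) en ee; lin.
apply/jnil_unit; first exact: in1ev.
exists k; rewrite -evXn ev_comp // comp_Xn_poly exprMn.
by rewrite ev_mulr // evXn.
Qed.

Lemma lamM x y : in1 e x -> in1 e y -> lam (x ** y) = lam x * lam y.
Proof.
move=> ex ey; have := lam_sqr (in1D ex ey).
rewrite jmulDl !jmulDr !lamD; auto with peirce; rewrite !lam_sqr // (jmulC y x) => h.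
apply: (mulfI two_neq0); move: h => /(congr1 (fun z => z - lam x * lam x - lam y * lam y)).
by move=> h; transitivity (lam (x ** y) + lam (x ** y)); [ring|]; move: h; move=> h; ring: h.
Qed.

Lemma lam_idem : lam e = 1.
Proof. by apply: lam_uniq => //; exists 0; rewrite /pw /= scale1r subrr. Qed.

Lemma lam_nil x : in1 e x -> jnil x -> lam x = 0.
Proof. by move=> ex nx; apply: lam_uniq => //; rewrite scale0r subr0. Qed.

End Local.


(** * The trace of a frame *)

(** Suppose the eigenvalue al of [a] is nonzero. Then Xk, which kills [b], is coprime to a power of
    X - al that kills [a], so some polynomial in x^2 without constant term takes the value e. Hence
    L_e commutes with L_x, and e(xx) = x(ex) reads a = x^2 / 2, forcing a = 0. *)
Lemma lam_eq0 e (le : local e) x a b k : inh e x -> x ** x = a + b -> in1 e a -> in0 e b ->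
  ev b b k = 0 -> ~~ root k (lam e a) -> lam e a = 0.
Proof.
have [ee e0 _] := le; move=> ex xE ea eb bk rk; set al := lam e a.
apply/eqP; apply: contraT => al0.
have [n an] : exists n, ev e a (('X - al%:P) ^+ n) = 0.
  have eal : in1 e (a - al *: e) by auto with peirce.
  have [n an] := iffRL (jnil_unit eal) (lamP le ea); exists n.
  rewrite -comp_Xn_poly -ev_comp // evXn evD evN evX evC (jmulC a) ea.
  exact: an.
have : coprimep (k * 'X) (('X - al%:P) ^+ n).
  by apply: coprimep_expr; rewrite coprimep_XsubC rootM rootX negb_or rk.
case/Bezout_eq1_coprimepP => -[u v] /= uv.
have pwE m : pw (a + b) (a + b) m = pw a a m + pw b b m /\ in1 e (pw a a m) /\ in0 e (pw b b m).
  elim: m => [|m [IH [ia ib]]] //=; rewrite -/(pw _ _ m) IH; split; last first.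
    by split; [apply: in11|apply: in00].
  by rewrite jmulDl !jmulDr (in10 ee ea ib) (jmulC b) (in10 ee ia eb) addr0 add0r.
have evE p : ev (a + b) (a + b) p = ev a a p + ev b b p.
  rewrite /ev -big_split /=; apply: eq_bigr => i _.
  by rewrite (pwE i).1 scalerDr.
have eE : e = ev (x ** x) (x ** x) (k * u).
  rewrite xE evE (ev_mulr _ bk) addr0 (ev_nonunital _ ea).
  rewrite -[LHS](ev1 e a) -uv evD (mulrC v) (ev_mulr _ an) addr0.
  by congr ev; ring.
have cx : lcomm x e.
  rewrite eE; apply: lcomm_sum => i _ z; rewrite !jmulZl jmulZr; congr (_ *: _).
  have xx2 : (x ** x) ** (x ** x) = pw x x 3.
    by rewrite -[RHS]/(x ** (x ** (x ** x))) (jmulC x (x ** x)) lcomm_sqr.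
  rewrite (@comm_pw (x ** x) (mul x)) // => [u' w|y|y]; first exact: jmulDr.
    by rewrite lcomm_sqr.
  by rewrite xx2 (lcomm_pw x 0 3).
have := cx x; rewrite ex jmulZr xE jmulDr ea eb addr0 => aE.
have a0 : a = 0.
  have := congr1 (mul e) aE; rewrite jmulZr jmulDr ea eb addr0 => aE'.
  by apply: (lincomb (lincombZ (- 2%:R) aE')); lin.
have n1 : jnil a by exists 0%N; rewrite a0.
have := lamP le ea; rewrite -scaleNr => /(jnil_uniq le ea n1) /eqP.
by rewrite oppr_eq0 (negPf al0).
Qed.

Lemma idemD e f : idem e -> idem f -> e ** f = 0 -> idem (e + f).
Proof.
by move=> ee ff ef; rewrite /idem jmulDl !jmulDr (jmulC f e) ee ff ef addr0 add0r.
Qed.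

Lemma in0_addl e f x : idem e -> idem f -> e ** f = 0 -> in0 (e + f) x -> in0 e x.
Proof.
move=> ee ff ef x0; apply: (in10 (idemD ee ff ef)) x0.
by rewrite /in1 jmulDl ee (jmulC f e) ef addr0.
Qed.

Lemma in0_addr e f x : idem e -> idem f -> e ** f = 0 -> in0 (e + f) x -> in0 f x.
Proof. by rewrite addrC jmulC => ee ff ef; apply: in0_addl. Qed.

Lemma in0_add e f x : in0 e x -> in0 f x -> in0 (e + f) x.
Proof. by rewrite /in0 jmulDl => -> ->; rewrite addr0. Qed.

Lemma lam_sqr_pair e f x : local e -> local f -> e ** f = 0 -> inh e x -> inh f x ->
  [/\ in1 (e + f) (x ** x) & lam e (U e (x ** x)) = lam f (U f (x ** x))].
Proof.
move=> le lf ef ex fx; have [[ee _ _] [ff _ _]] := (le, lf).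
have fe : f ** e = 0 by rewrite jmulC.
have xx : in1 (e + f) (x ** x).
  have h : in1 (e + f) x by rewrite /in1 jmulDl ex fx -mulr2n -scaler_nat double_half.
  by apply: in11 => //; apply: idemD.
split=> //; set a := e ** (x ** x); set b := f ** (x ** x).
have xE : x ** x = a + b by rewrite -jmulDl xx.
have [ea fb] : in1 e a /\ in1 f b by split; apply: inhh1.
have eb : in0 e b by have := inhh0 ee ex ex; rewrite -/a {1}xE addrAC subrr add0r.
have fa : in0 f a by have := inhh0 ff fx fx; rewrite -/b {1}xE addrK.
have UDl g y z : U g (y + z) = U g y + U g z by rewrite !UE; lin.
rewrite xE !UDl (U1 ee ea) (U0 ee eb) (U0 ff fa) (U1 ff fb) addr0 add0r.
(* If the eigenvalues differ, [lam_eq0] applies with a power of X - lam h d; used for (e, f) and for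
   (f, e), it makes both of them zero. *)
have main g h c d : local g -> local h -> inh g x -> x ** x = c + d -> in1 g c ->
    in0 g d -> in1 h d -> lam g c != lam h d -> lam g c = 0.
  move=> lg lh gx {}xE gc gd hd cd; have [hh _ _] := lh.
  have hdl : in1 h (d - lam h d *: h) by auto with peirce.
  have [n dn] := iffRL (jnil_unit hdl) (lamP lh hd).
  apply: (@lam_eq0 g lg x c d (('X - (lam h d)%:P) ^+ n)) => //.
    rewrite (ev_nonunital _ hd); apply: ev_mulr.
    by rewrite -comp_Xn_poly -ev_comp // evXn evD evN evX evC (jmulC d) hd.
  apply: contra cd; case: n {dn} => [|n]; first by rewrite expr0 rootE hornerC oner_eq0.
  by rewrite root_exp_XsubC.
have [//|ab] := eqVneq (lam e a) (lam f b).
by rewrite (main e f a b) // (main f e b a) // 1?addrC 1?eq_sym.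
Qed.

Definition is_lin (t : V -> F) := forall k x y, t (k *: x + y) = k * t x + t y.

Section Functional.
Variable t : V -> F.
Hypothesis tlin : is_lin t.

Lemma linD x y : t (x + y) = t x + t y.
Proof. by rewrite -[x]scale1r tlin scale1r mul1r. Qed.

Lemma lin0 : t 0 = 0.
Proof. by apply: (addrI (t 0)); rewrite -linD !addr0. Qed.

Lemma linZ k x : t (k *: x) = k * t x.
Proof. by rewrite -[k *: x]addr0 tlin lin0 addr0. Qed.

Lemma linN x : t (- x) = - t x.
Proof. by rewrite -scaleN1r linZ mulN1r. Qed.

(* Associativity of the form t(xy) on a Peirce-stable subalgebra K reduces to the two diagonal
   Peirce components once t weighs both components of a product of J_{1/2} elements equally. *)
Lemma trace_assoc (K : V -> Prop) e : idem e ->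
  (forall k x y, K x -> K y -> K (k *: x + y)) -> (forall x y, K x -> K y -> K (x ** y)) ->
  (forall x, K x -> K (e ** x)) ->
  (forall x, K x -> inh e x -> t x = 0) ->
  (forall x y, K x -> K y -> inh e x -> inh e y -> t (x ** y) = 2%:R * t (e ** (x ** y))) ->
  (forall a b c, K a -> K b -> K c -> in1 e a -> in1 e b -> in1 e c ->
     t ((a ** b) ** c) = t (a ** (b ** c))) ->
  (forall a b c, K a -> K b -> K c -> in0 e a -> in0 e b -> in0 e c ->
     t ((a ** b) ** c) = t (a ** (b ** c))) ->
  forall a b c, K a -> K b -> K c -> t ((a ** b) ** c) = t (a ** (b ** c)).
Proof.
move=> ee KL KM Ke th thh t1 t0.
have o x y : in1 e x -> in0 e y -> x ** y = 0 /\ y ** x = 0.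
  by move=> ex ey; rewrite (jmulC y) (in10 ee ex ey).
(* Homogeneous of even degree, with J_1 and J_0 even and J_1/2 odd; this [ev] shadows the polynomial
   value. *)
pose ev x := in1 e x \/ in0 e x.
have evh x y : ev x -> inh e y -> inh e (x ** y) by case=> ex ey; [apply: in1h|apply: in0h].
have hev x y : inh e x -> ev y -> inh e (x ** y) by move=> ? ?; rewrite jmulC; apply: evh.
have evev x y : ev x -> ev y -> ev (x ** y).
  move=> [ex|ex] [ey|ey].
  - by left; apply: in11.
  - by right; rewrite (o _ _ ex ey).1 /in0 jmul0r.
  - by right; rewrite (o _ _ ey ex).2 /in0 jmul0r.
  - by right; apply: in00.
have hhE x y z : inh e x -> inh e y -> inh e z -> inh e ((x ** y) ** z).
  move=> ex ey ez; rewrite -[x ** y](subrK (e ** (x ** y))) jmulDl.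
  have l : inh e ((x ** y - e ** (x ** y)) ** z) by apply: evh => //; right; apply: inhh0.
  have r : inh e ((e ** (x ** y)) ** z) by apply: evh => //; left; apply: inhh1.
  by rewrite /inh jmulDr l r scalerDr.
have cancel (x y z : F) : x = y + x - z -> z = y.
  move=> h; apply/eqP; rewrite -subr_eq0; have -> : z - y = x - (y + x - z) by ring.
  by rewrite -h subrr.
have key a b c : K a -> K b -> K c -> inh e a -> inh e b -> ev c ->
    t (a ** (b ** c)) = t (b ** (a ** c)) /\ t ((a ** b) ** c) = t (a ** (b ** c)).
  move=> Ka Kb Kc ea eb ec; have bc : inh e (b ** c) by rewrite jmulC; apply: evh.
  have ac : inh e (a ** c) by rewrite jmulC; apply: evh.
  have := thh a (b ** c) Ka (KM _ _ Kb Kc) ea bc; have := thh b (a ** c) Kb (KM _ _ Ka Kc) eb ac.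
  case: ec => ec.
    have := congr1 t (peirce_hh1 ea eb ec); have := congr1 t (peirce_hh1 eb ea ec).
    rewrite !linZ (jmulC b a) !(linD, linN) (jmulC c) => p q r s.
    by move: p q; rewrite -r -s => /cancel <- /cancel ->.
  have := congr1 t (peirce_hh0 ea eb ec); have := congr1 t (peirce_hh0 eb ea ec).
  rewrite !linZ (jmulC b a) !(linD, linN) (jmulC c) => p q r s.
  have e2 : t (a ** (b ** c)) = t (b ** (a ** c)) by rewrite r s p q [X in X - _]addrC.
  by split=> //; move: q; rewrite -r -e2 => /cancel <-.
(* With an odd number of J_1/2 factors both sides lie in J_1/2 and vanish by [th]; with two such
   factors [key] applies. *)
have hom a b c : K a -> K b -> K c -> ev a \/ inh e a -> ev b \/ inh e b -> ev c \/ inh e c ->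
    t ((a ** b) ** c) = t (a ** (b ** c)).
  move=> Ka Kb Kc.
  have Kl : K ((a ** b) ** c) by auto.
  have Kr : K (a ** (b ** c)) by auto.
  move=> [ea|ea] [eb|eb] [ec|ec].
  - case: ea eb ec => [ea|ea] [eb|eb] [ec|ec].
    + exact: t1.
    + by rewrite (o _ _ (in11 ee ea eb) ec).1 (o _ _ eb ec).1 jmul0r.
    + by rewrite (o _ _ ea eb).1 (o _ _ ec eb).2 jmul0l jmul0r.
    + by rewrite (o _ _ ea eb).1 (o _ _ ea (in00 ee eb ec)).1 jmul0l.
    + by rewrite (o _ _ eb ea).2 (o _ _ (in11 ee eb ec) ea).2 jmul0l.
    + by rewrite (o _ _ eb ea).2 (o _ _ eb ec).1 jmul0l jmul0r.
    + by rewrite (o _ _ ec (in00 ee ea eb)).2 (o _ _ ec eb).2 jmul0r.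
    + exact: t0.
  - by rewrite (th _ Kl (evh _ _ (evev _ _ ea eb) ec)) (th _ Kr (evh _ _ ea (evh _ _ eb ec))).
  - by rewrite (th _ Kl (hev _ _ (evh _ _ ea eb) ec)) (th _ Kr (evh _ _ ea (hev _ _ eb ec))).
  - have [p q] := key _ _ _ Kc Kb Ka ec eb ea.
    by rewrite (jmulC a b) jmulC -q (jmulC a) (jmulC b c).
  - by rewrite (th _ Kl (hev _ _ (hev _ _ ea eb) ec)) (th _ Kr (hev _ _ ea (evev _ _ eb ec))).
  - have [p q] := key _ _ _ Ka Kc Kb ea ec eb.
    by rewrite (jmulC b c) p jmulC.
  - by have [] := key _ _ _ Ka Kb Kc ea eb ec.
  - by rewrite (th _ Kl (hhE _ _ _ ea eb ec)) (th _ Kr) // jmulC; apply: hhE.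
have cases x : K x -> exists x1 x2 x3, [/\ x = x1 + x2 + x3, K x1, K x2 & K x3]
    /\ [/\ in1 e x1, inh e x2 & in0 e x3].
  move=> Kx; exists (U e x), (peirceh e x), (peirce0 e x).
  have KD u v : K u -> K v -> K (u + v) by move=> ? ?; rewrite -[u]scale1r; apply: KL.
  have K0 : K 0 by rewrite -(subrr x) -scaleN1r addrC; apply: KL.
  have KZ k u : K u -> K (k *: u) by move=> ?; rewrite -[k *: u]addr0; apply: KL.
  have KN u : K u -> K (- u) by move=> ?; rewrite -scaleN1r; apply: KZ.
  split; split; [exact: peirce_sum|rewrite UE ee; auto 8|rewrite /peirceh; auto 8
    |rewrite /peirce0; auto 8|exact: U_in1|exact: peirceh_in|exact: peirce0_in].
move=> a b c /cases[a1 [a2 [a3 [[-> ? ? ?] [? ? ?]]]]].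
move=> /cases[b1 [b2 [b3 [[-> ? ? ?] [? ? ?]]]]].
move=> /cases[c1 [c2 [c3 [[-> ? ? ?] [? ? ?]]]]].
have l x : in1 e x -> ev x \/ inh e x by left; left.
have r x : in0 e x -> ev x \/ inh e x by left; right.
have m x : inh e x -> ev x \/ inh e x by right.
by rewrite !(jmulDl, jmulDr) !linD !hom; auto; ring.
Qed.

End Functional.


(* [s] extends [g] by local idempotents, orthogonal to [g] and to each other, until J_0 is nil. *)
Fixpoint frame g s : Prop := match s with
  | [::] => forall x, in0 g x -> jnil x
  | f :: s' => [/\ local f, g ** f = 0 & frame (g + f) s']
  end.

Definition tr s x := \sum_(f <- s) lam f (U f x).

Lemma lam0 f : local f -> lam f 0 = 0.
Proof. by move=> lf; apply: lam_nil => //; [exact: jmul0r|exists 0%N]. Qed.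

Lemma tr_cons f s x : tr (f :: s) x = lam f (U f x) + tr s x.
Proof. by rewrite /tr big_cons. Qed.

Lemma frame_mem g s f : idem g -> frame g s -> f \in s -> local f /\ in0 g f.
Proof.
elim: s g => [|h s IH] //= g gg [lh gh fr]; have [hh _ _] := lh.
rewrite inE => /orP[/eqP->//|/(IH _ (idemD gg hh gh) fr)[lf /(in0_addl gg hh gh)]].
by split.
Qed.

Lemma U_lin f : forall k x y, U f (k *: x + y) = k *: U f x + U f y.
Proof. by move=> k x y; rewrite /U /tp; lin. Qed.

Lemma tr_lin g s : idem g -> frame g s -> is_lin (tr s).
Proof.
move=> gg fr k x y; rewrite /tr mulr_sumr -big_split /= big_seq [RHS]big_seq.
apply: eq_bigr => f /(frame_mem gg fr)[lf _]; have [ff _ _] := lf.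
by rewrite U_lin lamD ?lamZ //; first [exact: U_in1|apply/in1Z/U_in1].
Qed.

Lemma tr_eq0 g s x : idem g -> frame g s ->
  (forall f, local f -> in0 g f -> U f x = 0) -> tr s x = 0.
Proof.
move=> gg fr sx; rewrite /tr big_seq big1 // => f /(frame_mem gg fr)[lf gf].
by rewrite (sx f lf gf) lam0.
Qed.

(** U_h x stays in J_1/2(f) because L_h commutes with L_f, but it also lies in J_1(h), which [f]
    annihilates. *)
Lemma U_orth_half f h x : idem f -> idem h -> in0 f h -> inh f x -> U h x = 0.
Proof.
move=> ff hh fh fx; have := @U_in1 h hh x; set w := U h x => hw.
have fw : inh f w.
  by rewrite /inh /w UE hh jmulDr jmulNr jmulZr !(lcomm_in0 ff fh) fx !jmulZr; lin.
have : f ** w = 0 by rewrite jmulC (in10 hh hw) // /in0 jmulC.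
rewrite fw => /eqP; rewrite scaler_eq0 => /orP[|/eqP//].
by rewrite eq_sym (negPf half_neq0).
Qed.

Lemma U_orth1 f h x : idem f -> idem h -> in0 f h -> in1 f x -> U h x = 0.
Proof. by move=> ff hh fh fx; apply: U0 => //; rewrite /in0 jmulC (in10 ff fx fh). Qed.

(** After polarization this is the hypothesis [thh] of [trace_assoc]. Split x = u + v by the next
    idempotent h, with u in J_1/2(h) and v in J_0(h): u^2 is handled by [lam_sqr_pair], v^2 by
    induction, and uv lies in J_1/2(h). *)
Lemma tr_sqr s g f x : idem g -> local f -> g ** f = 0 -> in0 g x -> inh f x ->
  frame (g + f) s -> tr s (x ** x) = lam f (U f (x ** x)).
Proof.
elim: s g x => [|h s IH] g x gg lf gf gx fx fr; have [ff _ _] := lf.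
  rewrite /tr big_nil; have f1 := inhh1 ff fx fx; have f0 := inhh0 ff fx fx.
  set a := f ** (x ** x) in f1 f0; have xE : x ** x = a + (x ** x - a) by rewrite addrC subrK.
  have ga : in0 g a by rewrite /in0 /a (lcomm_in0 gg gf) (in00 gg gx gx) jmul0r.
  (* The frame is exhausted, so the J_0(f) component of x^2 is nil and [lam_eq0] applies with
     X^n. *)
  have [n bn] : jnil (x ** x - a).
    apply: fr; apply: in0_add => //.
    by rewrite /in0 jmulDr jmulNr ga subr0; apply: in00.
  have UE' : U f (x ** x) = a.
    by rewrite xE -[a in U f (a + _)]scale1r U_lin scale1r (U1 ff f1) (U0 ff f0) addr0.
  rewrite UE'; have [->//|a0] := eqVneq (lam f a) 0; symmetry.
  by apply: (lam_eq0 lf fx xE f1 f0 (k := 'X^n)); rewrite ?evXn ?rootE ?hornerXn ?expf_neq0.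
case: fr => lh gfh fr; have [hh _ _] := lh.
have gff := idemD gg ff gf; have fg : f ** g = 0 by rewrite jmulC.
have gh : in0 g h by apply: (in0_addl gg ff gf).
have fh : in0 f h by apply: (in0_addr gg ff gf).
have hf : in0 h f by rewrite /in0 jmulC.
have hg : h ** g = 0 by rewrite jmulC.
have := U_orth_half ff hh fh fx; rewrite UE hh => /eqP; rewrite subr_eq0 => /eqP hx.
pose u := 2%:R *: (h ** x); pose v := x - u.
have hu : inh h u by rewrite /inh /u jmulZr hx scalerA mulVf // scale1r.
have hv : in0 h v by rewrite /in0 jmulDr jmulNr jmulZr hx subrr.
have fu : inh f u by rewrite /inh /u jmulZr (in0h ff fh fx) scalerA mulrC -scalerA.
have fv : inh f v by rewrite /inh jmulDr jmulNr fx fu scalerBr.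
have gu : in0 g u by rewrite /in0 /u jmulZr (in00 gg gh gx) scaler0.
have gv : in0 g v by rewrite /in0 jmulDr jmulNr gx gu subrr.
have idh : idem (g + f + h) by apply: idemD.
have tlin := tr_lin idh fr.
have UD k y z : U k (y + z) = U k y + U k z by rewrite -{1}[y]scale1r U_lin scale1r.
have [fhuu lam_u] := lam_sqr_pair lf lh fh fu hu.
have trlamD k y z : local k -> lam k (U k (y + z)) = lam k (U k y) + lam k (U k z).
  by move=> lk; have [kk _ _] := lk; rewrite UD lamD //; apply: U_in1.
have huv : inh h (u ** v) by rewrite jmulC; apply: in0h.
have xE : x ** x = u ** u + v ** v + (u ** v + u ** v).
  by rewrite -[x in LHS](subrK u) -/v; lin.
have sub k : in0 (g + f + h) k -> in0 h k /\ in0 (f + h) k.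
  move=> k0; have hk : in0 h k by apply: (in0_addr gff hh gfh).
  have gfk : in0 (g + f) k by apply: (in0_addl gff hh gfh).
  by split=> //; apply: in0_add => //; apply: (in0_addr gg ff gf).
have tr_uv : tr s (u ** v) = 0.
  apply: (tr_eq0 idh fr) => k [kk _ _] /sub[hk _]; exact: (U_orth_half hh kk hk huv).
have tr_uu : tr s (u ** u) = 0.
  apply: (tr_eq0 idh fr) => k [kk _ _] /sub[_ fhk].
  exact: (U_orth1 (idemD ff hh fh) kk fhk fhuu).
have U_huv : U h (u ** v) = 0 by rewrite Uh.
have U_fuv : U f (u ** v) = 0 by apply: (U_orth_half hh ff hf huv).
have U_hvv : U h (v ** v) = 0 by rewrite U0 //; apply: in00.
have IHv : tr s (v ** v) = lam f (U f (v ** v)).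
  apply: (IH (g + h)) => //; first exact: idemD.
  - by rewrite jmulDl gf hf addr0.
  - exact: in0_add.
  - by rewrite addrAC.
rewrite tr_cons xE !trlamD // !(linD tlin) U_huv U_fuv U_hvv !lam0 // tr_uv tr_uu IHv lam_u.
by rewrite !addr0 add0r.
Qed.

(** Induction along the frame with [trace_assoc]: on J_1(f) the trace is the multiplicative [lam f],
    on J_0(f) it is the trace of the shorter frame. *)
Lemma tr_assoc s g : idem g -> frame g s -> forall a b c, in0 g a -> in0 g b -> in0 g c ->
  tr s ((a ** b) ** c) = tr s (a ** (b ** c)).
Proof.
elim: s g => [|f s IH] g gg fr; first by move=> *; rewrite /tr !big_nil.
have tlin := tr_lin gg fr; case: fr => lf gf fr; have [ff _ _] := lf.
have gff := idemD gg ff gf.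
have sub k : in0 (g + f) k -> in0 f k by apply: (in0_addr gg ff gf).
have tr1 x : in1 f x -> tr (f :: s) x = lam f x.
  move=> fx; rewrite tr_cons U1 // (tr_eq0 gff fr) ?addr0 // => k [kk _ _] /sub fk.
  exact: (U_orth1 ff kk fk fx).
have tr0 x : in0 f x -> tr (f :: s) x = tr s x by move=> fx; rewrite tr_cons U0 // (lam0 lf) add0r.
apply: (trace_assoc tlin ff) => //.
- by move=> k x y gx gy; rewrite /in0 jmulDr jmulZr gx gy scaler0 addr0.
- by move=> x y; apply: in00.
- by move=> x gx; apply: in00.
- move=> x gx fx; rewrite tr_cons Uh // (lam0 lf) add0r.
  by apply: (tr_eq0 gff fr) => k [kk _ _] /sub fk; apply: (U_orth_half ff kk fk fx).
- have UD y z : U f (y + z) = U f y + U f z by rewrite -{1}[y]scale1r U_lin scale1r.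
  have sqr x : in0 g x -> inh f x -> tr (f :: s) (x ** x) = 2%:R * tr (f :: s) (f ** (x ** x)).
    move=> gx fx; have f1 := inhh1 ff fx fx; have f0 := inhh0 ff fx fx.
    rewrite (tr1 _ f1) tr_cons (tr_sqr gg lf gf gx fx fr).
    have -> : U f (x ** x) = f ** (x ** x).
      by rewrite -{1}[x ** x](subrK (f ** (x ** x))) UD (U0 ff f0) add0r U1.
    by ring.
  move=> x y gx gy fx fy.
  have gxy : in0 g (x + y) by rewrite /in0 jmulDr gx gy addr0.
  have fxy : inh f (x + y) by rewrite /inh jmulDr fx fy scalerDr.
  have := sqr _ gxy fxy; rewrite !(jmulDl, jmulDr) !(linD tlin) (sqr x) // (sqr y) // (jmulC y x).
  set A := tr _ (x ** y); set B := tr _ (f ** (x ** y)) => h.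
  apply: (mulfI two_neq0); apply/eqP; rewrite -subr_eq0; apply/eqP.
  set X := tr _ (f ** (x ** x)) in h; set Y := tr _ (f ** (y ** y)) in h.
  transitivity (2%:R * X + A + (A + 2%:R * Y) - 2%:R * (X + B + (B + Y))); first by ring.
  by rewrite h subrr.
- move=> a b c ga gb gc fa fb fc.
  rewrite !tr1 ?(lamM lf) ?mulrA //; auto using in11.
- move=> a b c ga gb gc fa fb fc.
  rewrite !tr0; try by [do ?apply: in00].
  by apply: (IH _ gff fr); apply: in0_add.
Qed.

(** [P] need not be decidable: classically, a missing vector is adjoined until none is left, and [n]
    bounds the codimension. *)
Lemma prop_vspace (P : V -> Prop) : P 0 -> (forall k x y, P x -> P y -> P (k *: x + y)) ->
  exists W : {vspace V}, forall x, x \in W <-> P x.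
Proof.
move=> P0 PL.
suff: forall n (W : {vspace V}), (forall x, x \in W -> P x) -> (dim V - \dim W <= n)%N ->
    exists W : {vspace V}, forall x, x \in W <-> P x.
  by move=> /(_ (dim V) 0%VS); apply=> [x|]; rewrite ?leq_subr // memv0 => /eqP->.
elim=> [|n IH] W WP dW; case: (classic (exists2 x, P x & x \notin W)) => [[x Px xW]|nex].
- move: dW; rewrite leqn0 subn_eq0 -dimvf => dW; case/negP: xW.
  have /eqP-> : W == fullv by rewrite eqEdim subvf.
  exact: memvf.
- by exists W => x; split=> [/WP//|Px]; apply: contraT => xW; case: nex; exists x.
- apply: (IH (W + <[x]>)%VS).
    move=> _ /memv_addP[w wW [_ /vlineP[k ->] ->]].
    by rewrite addrC; apply: PL => //; apply: WP.
  have ltW : (\dim W < \dim (W + <[x]>))%N.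
    rewrite ltnNge; apply: contra xW => le.
    have /eqP-> : W == (W + <[x]>)%VS by rewrite eqEdim addvSl.
    exact: (subvP (addvSr W <[x]>%VS) x (memv_line x)).
  by rewrite -ltnS (leq_trans _ dW) // ltn_sub2l // -dimvf (leq_trans ltW) // dimvS // subvf.
- by exists W => x; split=> [/WP//|Px]; apply: contraT => xW; case: nex; exists x.
Qed.


(** * Existence of primitive idempotents and frames *)

Lemma idem0 : idem 0.
Proof. exact: jmul0l. Qed.

Lemma vspace_in1 e : exists W : {vspace V}, forall x, x \in W <-> in1 e x.
Proof. by apply: prop_vspace => [|k x y ex ey]; [exact: jmul0r|apply/in1D/ey/in1Z]. Qed.

Lemma vspace_in0 e : exists W : {vspace V}, forall x, x \in W <-> in0 e x.
Proof.
apply: prop_vspace => [|k x y ex ey]; first exact: jmul0r.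
by rewrite /in0 jmulDr jmulZr ex ey scaler0 addr0.
Qed.

Lemma dim_proper (W1 W2 : {vspace V}) x :
  (W1 <= W2)%VS -> x \in W2 -> x \notin W1 -> (\dim W1 < \dim W2)%N.
Proof.
move=> s12 x2; apply: contraR; rewrite -leqNgt => le21.
by have /eqP-> : W1 == W2 by rewrite eqEdim s12.
Qed.

(** Induction on dim J_1(g): an idempotent k of J_1(g) other than 0 and g has a smaller J_1(k),
    which misses g. *)
Lemma local_exists g : idem g -> g <> 0 -> exists2 f, local f & in1 g f.
Proof.
have [W gW] := vspace_in1 g.
have [n le_n] := ubnP (\dim W); elim: n => // n IH in g W gW le_n * => gg g0.
case: (classic (exists k, [/\ idem k, in1 g k, k <> 0 & k <> g])) => [[k [kk gk k0 kg]]|nk].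
  have kgk : k ** (g - k) = 0 by rewrite jmulDr jmulNr (jmulC k) gk kk subrr.
  have sub x : in1 k x -> in1 g x.
    move=> kx; rewrite /in1 -[g](subrK k) jmulDl kx [_ ** x]jmulC.
    by rewrite (in10 kk kx kgk) add0r.
  have [W' kW] := vspace_in1 k.
  have [|||f lf kf] // := IH k W' kW; last by exists f => //; apply: sub.
  rewrite -ltnS (leq_trans _ le_n) // ltnS; apply: (@dim_proper _ _ g).
  - by apply/subvP => x /kW/sub/gW.
  - exact/gW.
  - by apply/negP => /kW; rewrite /in1 jmulC gk => /kg.
exists g => //; split=> // k kk gk.
case: (classic (k = 0)) => [|k0]; first by left.
by case: (classic (k = g)) => [|kg]; [right|case: nk; exists k].
Qed.

(** Induction on dim J_0(g): a non-nil element of J_0(g) yields a primitive idempotent f there, and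
    J_0(g + f) misses f. *)
Lemma frame_exists g : idem g -> exists s, frame g s.
Proof.
have [W gW] := vspace_in0 g.
have [n le_n] := ubnP (\dim W); elim: n => // n IH in g W gW le_n * => gg.
case: (classic (exists2 y, in0 g y & ~ jnil y)) => [[y gy ny]|nex]; last first.
  by exists [::] => x gx; case: (classic (jnil x)) => // nx; case: nex; exists x.
have [/ny//|[q k0 kk]] := nil_or_idem y; set k := ev y y q in k0 kk.
have gk : in0 g k.
  rewrite /k; elim/poly_ind: q {k k0 kk} => [|q c IHq]; first by rewrite ev0 /in0 jmul0r.
  rewrite evD evMX evC /in0 jmulDr jmulZr gy scaler0 addr0.
  exact: in00.
have [f lf kf] := local_exists kk (elimN eqP k0); have [ff f0 _] := lf.
have gf : g ** f = 0 by rewrite jmulC (in10 kk kf) // /in0 jmulC.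
have [W' gfW] := vspace_in0 (g + f).
have ltW : (\dim W' < n)%N.
  rewrite -ltnS (leq_trans _ le_n) // ltnS; apply: (@dim_proper _ _ f).
  - by apply/subvP => x /gfW/(in0_addl gg ff gf)/gW.
  - exact/gW.
  - by apply/negP => /gfW; rewrite /in0 jmulDl gf ff add0r.
by have [s fr] := IH _ W' gfW ltW (idemD gg ff gf); exists (f :: s).
Qed.

(** * Traces and the radical of their forms *)

Definition trace t := is_lin t /\ forall a b x, t (der a b x) = 0.

Lemma local_trace f : local f -> exists2 t, trace t & t f = 1.
Proof.
move=> lf; have [ff _ _] := lf.
have gf : 0 ** f = 0 by rewrite jmul0l.
have [s fr] := frame_exists (idemD idem0 ff gf).
(* J_0(0) is the whole algebra, so a frame over 0 that starts with [f] makes [tr_assoc] global. *)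
have fr0 : frame 0 (f :: s) by [].
have tlin := tr_lin idem0 fr0.
exists (tr (f :: s)); first split=> // a b x.
  have as0 := tr_assoc idem0 fr0 (jmul0l _) (jmul0l _) (jmul0l _).
  by rewrite /der (linD tlin) (linN tlin) (jmulC a (b ** x)) (jmulC b (a ** x)) (jmulC b x)
    (jmulC a x) !as0 (jmulC a b) subrr.
rewrite tr_cons U1 // lam_idem // (tr_eq0 (idemD idem0 ff gf) fr) ?addr0 // => k [kk _ _].
move=> /(in0_addr idem0 ff gf) fk; exact: (U_orth1 ff kk fk ff).
Qed.

Definition in_radical w := forall t, trace t -> forall z, t (w ** z) = 0.

Lemma radical0 : in_radical 0.
Proof. by move=> t [tlin _] z; rewrite jmul0l (lin0 tlin). Qed.

Lemma radical_lin k x y : in_radical x -> in_radical y -> in_radical (k *: x + y).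
Proof.
move=> xR yR t tt z; have [tlin _] := tt.
by rewrite jmulDl jmulZl tlin (xR t) // (yR t) // mulr0 addr0.
Qed.

Lemma radical_mul x y : in_radical x -> in_radical (x ** y).
Proof.
move=> xR t tt z; have [tlin tder] := tt.
have := tder z x y; rewrite /der (linD tlin) (linN tlin) (xR t tt) subr0.
by rewrite jmulC.
Qed.

(** Otherwise the radical contains an idempotent k, and a primitive f in J_1(k) has kf = f; the
    trace with t(f) = 1 contradicts t(kf) = 0. *)
Lemma radical_nil y : in_radical y -> jnil y.
Proof.
move=> yR; have [//|[q k0 kk]] := nil_or_idem y; set k := ev y y q in k0 kk.
have kR : in_radical k.
  rewrite /k; elim/poly_ind: q {k k0 kk} => [|q c IHq]; first by rewrite ev0; apply: radical0.
  by rewrite evD evMX evC addrC; apply: radical_lin => //; apply: radical_mul.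
have [f lf kf] := local_exists kk (elimN eqP k0).
have [t tt tf] := local_trace lf.
by have /eqP := kR t tt f; rewrite kf tf oner_eq0.
Qed.

Lemma radical_eq0 x : jsemisimple mul -> in_radical x -> x = 0.
Proof.
move=> ss xR; have [W RW] := prop_vspace radical0 radical_lin.
have W0 : W = 0%VS.
  apply: ss => [y z|y] /RW yR; last exact/jnil_jnilpotent/radical_nil.
  by rewrite (jmulC y); split; apply/RW/radical_mul.
by apply/eqP; rewrite -memv0 -W0; apply/RW.
Qed.

(** * 2-local inner derivations *)

Lemma inner_derM D : is_inner_derivation mul D ->
  (forall x y, D (x ** y) = D x ** y + x ** D y) /\ (forall t x, trace t -> t (D x) = 0).
Proof.
case=> s Ds; split=> [x y|t x [tlin tder]].
  rewrite !Ds (big_morph (mul x) (jmulDr x) (jmul0r x)).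
  rewrite (big_morph (fun z => z ** y) (fun a b => jmulDl a b y) (jmul0l y)) -big_split /=.
  by apply: eq_bigr => p _; apply: derM.
rewrite Ds (big_morph t (linD tlin) (lin0 tlin)) big1 // => p _; exact: tder.
Qed.

Lemma two_local_trace Delta t x y : is_2local_inner_derivation mul Delta -> trace t ->
  t (Delta x ** y) = - t (x ** Delta y).
Proof.
move=> D2 tt; have [tlin _] := tt; have [D [/inner_derM[DM Dt] -> ->]] := D2 x y.
by apply/eqP; rewrite -addr_eq0 -(linD tlin) -DM Dt.
Qed.

Lemma two_local_derivation Delta : jsemisimple mul ->
  is_2local_inner_derivation mul Delta -> is_derivation mul Delta.
Proof.
move=> ss D2.
have DL a x y : Delta (a *: x + y) = a *: Delta x + Delta y.
  apply/eqP; rewrite -subr_eq0; apply/eqP/radical_eq0 => // t tt z; have [tlin _] := tt.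
  rewrite jmulDl jmulNl jmulDl jmulZl (linD tlin) (linN tlin) tlin !(two_local_trace _ _ D2 tt).
  by rewrite jmulDl jmulZl tlin; ring.
split=> // x y.
have DD u v : Delta (u + v) = Delta u + Delta v by rewrite -[u]scale1r DL !scale1r.
(* The 2-local condition for the pair [u], [u ** u] provides one derivation for both. *)
have Dsqr u : Delta (u ** u) = 2%:R *: (u ** Delta u).
  have [D [/inner_derM[DM _] -> ->]] := D2 u (u ** u).
  by rewrite DM; lin.
have := Dsqr (x + y); rewrite jmulDl !jmulDr !DD !Dsqr (jmulC y x) => h.
by apply: (lincomb (lincombZ half h)); lin.
Qed.

End JordanAlgebra.

Theorem theorem3p6 (F : closedFieldType) (V : vectType F) (mul : V -> V -> V)
    (Delta : V -> V) :
  (2%N \notin [pchar F]) ->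
  is_jordan_algebra mul ->
  jsemisimple mul ->
  is_2local_inner_derivation mul Delta ->
  is_derivation mul Delta.
Proof.
move=> char2 J ss D2; apply: (two_local_derivation _ J ss D2).
by apply: contra char2 => two0; rewrite inE.
Qed.
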